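(* Let $t,b,k$ be positive integers with $4 \le k \le t$ such that $\ell = bk/(t(t-1))$ is an integer. Under model $(\mathcal{M}2)$, a circular design neighbor-balanced at distances 1 and 2, $d^*\in\Omega_{(t,b,k)}$, is universally optimal for the vector of total effects $\psi=\tau+\lambda+\rho$ over the class of all designs $d\in\Omega_{(t,b,k)}$ in which no treatment is a neighbor of itself at distance 1 or 2, i.e. $d(i,j)\neq d(i,j-1)$ and $d(i,j-1)\ne d(i,j+1)$ for all $1\le i\le b$, $1\le j\le k$.
   Context: Designs: there are $t$ treatments labelled $1,\dots,t$ and $b$ linear blocks. Block $i$ has inner plots $j=1,\dots,k$ and two border plots $j=0$ and $j=k+1$. A design $d$ assigns a treatment $d(i,j)$ to each plot, and is circular if $d(i,0)=d(i,k)$ and $d(i,k+1)=d(i,1)$ for all $i$. $\Omega_{(t,b,k)}$ is the set of all circular designs with $t$ treatments and $b$ blocks of length $k$. Model $(\mathcal{M}2)$: responses $Y_{i,j}$ ($1\le i\le b$, $1\le j\le k$) are uncorrelated with common variance and $\mathbb{E}(Y_{i,j})=\beta_i+\tau_{d(i,j)}+\lambda_{d(i,j-1)}+\rho_{d(i,j+1)}$; in vector form $\mathbb{E}(Y)=B\beta+T_d\tau+L_d\lambda+R_d\rho$, where $B$ is the block incidence matrix and $T_d,L_d,R_d$ ($bk\times t$) have in row $(i,j)$ a single $1$ in column $d(i,j)$, $d(i,j-1)$, $d(i,j+1)$ respectively. The total effects are $\psi=K'\alpha$ with $\alpha=(\tau',\lambda',\rho')'$, $K=\mathbf{1}_3\otimes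 I_t$. Information matrices: $A^+$ is the Moore–Penrose inverse, $\mathrm{pr}_{(A)}=A(A'A)^+A'$, $\mathrm{pr}^\perp_{(A)}=I-\mathrm{pr}_{(A)}$. In a model $\mathbb{E}(Y)=A\alpha+B\beta$ with uncorrelated homoscedastic errors, $C[\alpha]=A'\mathrm{pr}^\perp_{(B)}A$ and $C[K'\alpha]=X_1'\mathrm{pr}^\perp_{(X_2)}X_1$ with $X_1=AK(K'K)^+$, $X_2=(AM\mid B)$, $M=I-K(K'K)^+K'$. $C_d[\psi]$ is this matrix with $A=(T_d\mid L_d\mid R_d)$. A circular neighbor-balanced design (CNBD) is a design in $\Omega_{(t,b,k)}$ which is binary (each treatment at most once among the inner plots of each block), is a balanced block design (equal replication of treatments on inner plots and each unordered pair of distinct treatments occurring together in the same number of blocks), and such that for each ordered pair $(a,c)$ of distinct treatments exactly $\ell$ inner plots $(i,j)$ have $d(i,j)=a$, $d(i,j+1)=c$. A circular design neighbor-balanced at distances 1 and 2 (CNBD2) is a CNBD such that in addition for each ordered pair $(a,c)$ of distinct treatments exactly $\ell$ inner plots $(i,j)$ have $d(i,j-1)=a$ and $d(i,j+1)=c$. Universal optimality (Kiefer): $d^*$ is universally optimal over $\mathcal{D}$ if $\Phi(C_{d^*})\le\Phi(C_d)$ for all $d\in\mathcal{D}$ and every $\Phi$ on nonnegative definite symmetric $t\times t$ matrices, with values in $(-\infty,\infty]$, that is convex, has $\Phi(aC)$ nonincreasing in $a\ge0$, and is invariant under simultaneous permutation of rows and columns. *)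

(* Defs.v *)
From HB Require Import structures.
From mathcomp Require Import all_boot all_order all_algebra all_fingroup.
From mathcomp Require Import zify.
From mathcomp Require Import constructive_ereal reals.
From Stdlib Require Import ClassicalEpsilon.
Set Implicit Arguments. Unset Strict Implicit. Unset Printing Implicit Defensive.
Import Order.TTheory GRing.Theory Num.Theory.
Local Open Scope ring_scope.

(* A circular design in Omega_(t,b,k) is determined by its inner plots:
   d i j : 'I_t is the treatment on inner plot j (0-indexed, j = 0..k-1,
   i.e. plot j+1 of the paper) of block i.  Border plots are determined by
   circularity: the left neighbour of plot j is plot (j-1 mod k) and the right
   neighbour is plot (j+1 mod k). *)
Definition design (t b k : nat) := 'I_b -> 'I_k -> 'I_t.

Definition lnb (k : nat) (j : 'I_k) : 'I_k := ord_pred j.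
Definition rnb (k : nat) (j : 'I_k) : 'I_k := ordS j.

(* Decoding of observation index r = i*k + j (row (i,j) of the bk x _ matrices). *)
Lemma blk_subproof (b k : nat) (r : 'I_(b * k)) : (r %/ k < b)%N.
Proof.
case: r => r /= Hr; have Hk : (0 < k)%N by case: k Hr => //; rewrite muln0.
by rewrite ltn_divLR.
Qed.
Lemma plt_subproof (b k : nat) (r : 'I_(b * k)) : (r %% k < k)%N.
Proof.
case: r => r /= Hr; have Hk : (0 < k)%N by case: k Hr => //; rewrite muln0.
by rewrite ltn_pmod.
Qed.
Definition blk (b k : nat) (r : 'I_(b * k)) : 'I_b := Ordinal (blk_subproof r).
Definition plt (b k : nat) (r : 'I_(b * k)) : 'I_k := Ordinal (plt_subproof r).

Section Matrices.
Variable R : realType.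

Definition is_MPinv (m n : nat) (A : 'M[R]_(m, n)) (X : 'M[R]_(n, m)) : Prop :=
  [/\ A *m X *m A = A, X *m A *m X = X,
      (A *m X)^T = A *m X & (X *m A)^T = X *m A].
Definition MPinv (m n : nat) (A : 'M[R]_(m, n)) : 'M[R]_(n, m) :=
  epsilon (inhabits 0) (is_MPinv A).

Definition pr (m n : nat) (A : 'M[R]_(m, n)) : 'M[R]_m :=
  A *m MPinv (A^T *m A) *m A^T.
Definition prperp (m n : nat) (A : 'M[R]_(m, n)) : 'M[R]_m := 1%:M - pr A.

Variables (t b k : nat).

Definition Bmx : 'M[R]_(b * k, b) := \matrix_(r, i) ((blk r == i)%:R).
Definition Tmx (d : design t b k) : 'M[R]_(b * k, t) :=
  \matrix_(r, c) ((d (blk r) (plt r) == c)%:R).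
Definition Lmx (d : design t b k) : 'M[R]_(b * k, t) :=
  \matrix_(r, c) ((d (blk r) (lnb (plt r)) == c)%:R).
Definition Rmx (d : design t b k) : 'M[R]_(b * k, t) :=
  \matrix_(r, c) ((d (blk r) (rnb (plt r)) == c)%:R).

(* A = (T_d | L_d | R_d), alpha = (tau', lambda', rho')'. *)
Definition Amx (d : design t b k) : 'M[R]_(b * k, t + t + t) :=
  row_mx (row_mx (Tmx d) (Lmx d)) (Rmx d).
Definition Kmx : 'M[R]_(t + t + t, t) := col_mx (col_mx 1%:M 1%:M) 1%:M.

Definition info_psi (d : design t b k) : 'M[R]_t :=
  let KKp := MPinv (Kmx^T *m Kmx) in
  let X1 := Amx d *m Kmx *m KKp in
  let M := 1%:M - Kmx *m KKp *m Kmx^T in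
  let X2 := row_mx (Amx d *m M) Bmx in
  X1^T *m prperp X2 *m X1.

End Matrices.

Section Comb.
Variables (t b k : nat).
Implicit Type d : design t b k.

Definition binary d : Prop := forall i : 'I_b, injective (d i).

Definition replication d (a : 'I_t) : nat :=
  #|[set p : 'I_b * 'I_k | d p.1 p.2 == a]|.

Definition concurrence d (a c : 'I_t) : nat :=
  #|[set i : 'I_b | [exists j, d i j == a] && [exists j, d i j == c]]|.

Definition BBD d : Prop :=
  (forall a c : 'I_t, replication d a = replication d c) /\
  (exists lam : nat, forall a c : 'I_t, a != c -> concurrence d a c = lam).

Definition CNBD (l : nat) d : Prop :=
  binary d /\ BBD d /\
  forall a c : 'I_t, a != c ->
    #|[set p : 'I_b * 'I_k | (d p.1 p.2 == a) && (d p.1 (rnb p.2) == c)]| = l.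

Definition CNBD2 (l : nat) d : Prop :=
  CNBD l d /\
  forall a c : 'I_t, a != c ->
    #|[set p : 'I_b * 'I_k |
        (d p.1 (lnb p.2) == a) && (d p.1 (rnb p.2) == c)]| = l.

Definition no_self_nb d : Prop :=
  forall (i : 'I_b) (j : 'I_k), d i j != d i (lnb j) /\ d i (lnb j) != d i (rnb j).

End Comb.

Section UO.
Variables (R : realType) (t : nat).
Local Open Scope ereal_scope.

Definition nnd_sym (C : 'M[R]_t) : Prop :=
  C^T = C /\ forall x : 'cV[R]_t, (0 <= (x^T *m C *m x) ord0 ord0)%R.

Definition Kiefer_criterion (Phi : 'M[R]_t -> \bar R) : Prop :=
  [/\ (forall C, nnd_sym C -> Phi C != -oo),
      (forall C1 C2 (a : R), nnd_sym C1 -> nnd_sym C2 -> (0 < a < 1)%R ->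
         Phi (a *: C1 + (1 - a) *: C2)%R <= a%:E * Phi C1 + (1 - a)%R%:E * Phi C2),
      (forall C (a a' : R), nnd_sym C -> (0 <= a <= a')%R ->
         Phi (a' *: C)%R <= Phi (a *: C)%R) &
      (forall C (s : 'S_t), nnd_sym C ->
         Phi (\matrix_(i, j) C (s i) (s j)) = Phi C)].

Definition universally_optimal (T : Type) (Cmx : T -> 'M[R]_t)
    (D : T -> Prop) (dstar : T) : Prop :=
  forall Phi, Kiefer_criterion Phi -> forall d, D d -> Phi (Cmx dstar) <= Phi (Cmx d).

End UO.

(* Main.v *)
(* Write X = (T_d + L_d + R_d)/3 and let Q project onto the complement of the
   block effects.  Since B is part of the nuisance matrix X2, C_d[psi] is
   X'Q prperp(X2) Q X, so tr C_d[psi] <= tr X'QX.  When no treatment is its own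
   neighbour at distance 1 or 2, each row of X has exactly three entries 1/3, so
   tr X'QX = bk/3 - (1/k) sum_(i,c) n_ic^2 <= bk/3 - b, where the n_ic count
   treatment c in block i and sum to k over c.  For a CNBD2, T'QX = L'QX = R'QX,
   hence QX is orthogonal to X2 and C[psi] = X'QX is completely symmetric with
   trace exactly bk/3 - b.  Averaging C_d[psi] over simultaneous row and column
   permutations then yields universal optimality. *)
Require Import Defs.
From mathcomp Require Import all_boot all_order all_algebra all_fingroup.
From mathcomp Require Import constructive_ereal reals.
From mathcomp Require Import zify ring lra.
From Stdlib Require Import ClassicalEpsilon.
Set Implicit Arguments. Unset Strict Implicit. Unset Printing Implicit Defensive.
Import Order.TTheory GRing.Theory Num.Theory.
Local Open Scope ring_scope.

(** * Moore-Penrose inverses and orthogonal projections *)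

Section Projections.
Variable R : realType.

Lemma tr_gram m n (A : 'M[R]_(m, n)) :
  \tr (A^T *m A) = \sum_j \sum_i A i j ^+ 2.
Proof.
by apply: eq_bigr => j _; rewrite mxE; apply: eq_bigr => i _; rewrite mxE expr2.
Qed.

Lemma tr_gram_ge0 m n (A : 'M[R]_(m, n)) : 0 <= \tr (A^T *m A).
Proof. by rewrite tr_gram; do 2 apply: sumr_ge0 => ? _; apply: sqr_ge0. Qed.

Lemma gram_eq0 m n (A : 'M[R]_(m, n)) : A^T *m A = 0 -> A = 0.
Proof.
move=> A0; have := tr_gram A; rewrite A0 mxtrace0 => /esym /eqP.
rewrite psumr_eq0 => [/allP H|j _]; last by apply: sumr_ge0 => i _; apply: sqr_ge0.
apply/matrixP => i j; rewrite mxE.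
have := H j (mem_index_enum _); rewrite psumr_eq0 => [/allP H'|? _]; last exact: sqr_ge0.
by have := H' i (mem_index_enum _); rewrite /= sqrf_eq0 => /eqP.
Qed.

Lemma row_free_gram_unit m n (G : 'M[R]_(m, n)) :
  row_free G -> G *m G^T \in unitmx.
Proof.
move=> fG; rewrite -row_free_unit; apply: inj_row_free => v vG0.
apply/eqP; rewrite -(mulmx_free_eq0 _ fG); apply/eqP.
apply: trmx_inj; rewrite trmx0; apply: gram_eq0.
by rewrite trmxK trmx_mul mulmxA -(mulmxA v) vG0 mul0mx.
Qed.

(** [MPinv] is chosen by [epsilon], so an inverse has to be exhibited: for a full-rank factorization
    A = FG it is G'(GG')^-1 (F'F)^-1 F'. *)
Lemma MPinvP m n (A : 'M[R]_(m, n)) : is_MPinv A (MPinv A).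
Proof.
rewrite /MPinv; apply: epsilon_spec.
have fG : row_free (row_base A) := row_base_free A.
have fF : row_free (col_base A)^T by rewrite /row_free mxrank_tr; apply: col_base_full.
have uG := row_free_gram_unit fG; have := row_free_gram_unit fF; rewrite trmxK => uF.
have AE := mulmx_base A.
move: (col_base A) (row_base A) uG uF AE => F G uG uF <-.
set IG := invmx (G *m G^T); set IF := invmx (F^T *m F).
have IGs : IG^T = IG by rewrite trmx_inv trmx_mul trmxK.
have IFs : IF^T = IF by rewrite trmx_inv trmx_mul trmxK.
exists (G^T *m IG *m (IF *m F^T)).
have E1 : F *m G *m (G^T *m IG *m (IF *m F^T)) = F *m IF *m F^T.
  by rewrite !mulmxA -(mulmxA F G) -(mulmxA F (G *m _)) (mulmxV uG) mulmx1.
have E2 : G^T *m IG *m (IF *m F^T) *m (F *m G) = G^T *m IG *m G.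
  by rewrite !mulmxA -(mulmxA _ F^T F) -(mulmxA _ IF) (mulVmx uF) mulmx1.
split; rewrite ?E1 ?E2.
- by rewrite !mulmxA -(mulmxA _ F^T F) -(mulmxA _ IF) (mulVmx uF) mulmx1.
- by rewrite !mulmxA -(mulmxA _ G G^T) -(mulmxA _ IG (G *m G^T)) (mulVmx uG) mulmx1.
- by rewrite !trmx_mul trmxK IFs mulmxA.
- by rewrite !trmx_mul trmxK IGs mulmxA.
Qed.

Lemma MPinv_scalar n (a : R) : a != 0 -> MPinv (a%:M : 'M_n) = a^-1%:M.
Proof.
move=> a0; have [+ _ _ _] := MPinvP (a%:M : 'M_n).
rewrite mul_scalar_mx mul_mx_scalar scalerA => /(congr1 (fun M => (a * a)^-1 *: M)).
by rewrite scalerA mulVf ?mulf_neq0 // scale1r scale_scalar_mx invfM mulfVK.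
Qed.

(** The difference of the two sides is A(HA'A - I). Its Gram matrix contains the factor A'A(HA'A -
    I), which vanishes for every generalized inverse H of A'A. *)
Lemma gram_ginvK m n (A : 'M[R]_(m, n)) (H : 'M_n) :
  A^T *m A *m H *m (A^T *m A) = A^T *m A -> A *m H *m (A^T *m A) = A.
Proof.
move=> HG; apply/eqP; rewrite -subr_eq0; apply/eqP; apply: gram_eq0.
have -> : A *m H *m (A^T *m A) - A = A *m (H *m (A^T *m A) - 1%:M).
  by rewrite mulmxBr mulmx1 !mulmxA.
rewrite trmx_mul -mulmxA (mulmxA A^T A) [A^T *m A *m _]mulmxBr mulmx1.
by rewrite [A^T *m A *m _]mulmxA HG subrr mulmx0.
Qed.

Lemma pr_id m n (A : 'M[R]_(m, n)) : pr A *m A = A.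
Proof.
by have [HG _ _ _] := MPinvP (A^T *m A); rewrite /pr -mulmxA gram_ginvK.
Qed.

Lemma tr_pr m n (A : 'M[R]_(m, n)) : (pr A)^T = pr A.
Proof.
(* Symmetry is obtained without knowing that the inverse of A'A is symmetric: [pr A] is a product of
   the form PP'. *)
have E : pr A *m (pr A)^T = pr A.
  have prA : A^T *m (pr A)^T = A^T by rewrite -trmx_mul pr_id.
  by rewrite {1 3}/pr -mulmxA prA.
by rewrite -E trmx_mul trmxK E.
Qed.

Lemma pr_idem m n (A : 'M[R]_(m, n)) : pr A *m pr A = pr A.
Proof. by rewrite {2}/pr !mulmxA pr_id. Qed.

Lemma prperp_mul0 m n (A : 'M[R]_(m, n)) : prperp A *m A = 0.
Proof. by rewrite mulmxBl mul1mx pr_id subrr. Qed.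

Lemma tr_prperp m n (A : 'M[R]_(m, n)) : (prperp A)^T = prperp A.
Proof. by rewrite linearB /= trmx1 tr_pr. Qed.

Lemma prperp_idem m n (A : 'M[R]_(m, n)) : prperp A *m prperp A = prperp A.
Proof.
by rewrite {2}/prperp mulmxBr mulmx1 /pr !mulmxA prperp_mul0 !mul0mx subr0.
Qed.

Lemma prperp_orth m n p (A : 'M[R]_(m, n)) (Y : 'M_(m, p)) :
  A^T *m Y = 0 -> prperp A *m Y = Y.
Proof. by move=> AY; rewrite mulmxBl mul1mx -mulmxA AY mulmx0 subr0. Qed.

(** Pythagoras: the two traces differ by that of the Gram matrix of [pr A *m Y]. *)
Lemma tr_prperp_le m n p (A : 'M[R]_(m, n)) (Y : 'M_(m, p)) :
  \tr (Y^T *m prperp A *m Y) <= \tr (Y^T *m Y).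
Proof.
rewrite -subr_ge0 -raddfB /= -mulmxBl -{1}[Y^T]mulmx1 -mulmxBr subKr.
have -> : Y^T *m pr A *m Y = (pr A *m Y)^T *m (pr A *m Y).
  move: (pr_idem A) (tr_pr A); move: (pr A) => P PP Ps.
  by rewrite trmx_mul Ps !mulmxA -(mulmxA _ P P) PP.
exact: tr_gram_ge0.
Qed.

End Projections.

(** * Kiefer criteria and completely symmetric matrices *)

Section Kiefer.
Variables (R : realType) (t : nat).
Implicit Types (C : 'M[R]_t) (s : 'S_t).

Lemma nnd_gram m (A : 'M[R]_(m, t)) : nnd_sym (A^T *m A).
Proof.
split; first by rewrite trmx_mul trmxK.
move=> x; have := tr_gram_ge0 (A *m x).
by rewrite trmx_mul !mulmxA /mxtrace big_ord1.
Qed.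

Lemma nnd_scale C (a : R) : 0 <= a -> nnd_sym C -> nnd_sym (a *: C).
Proof.
move=> a0 [Cs Cp]; split; first by rewrite linearZ /= Cs.
by move=> x; rewrite -scalemxAr -scalemxAl mxE mulr_ge0.
Qed.

Lemma nnd_add C1 C2 : nnd_sym C1 -> nnd_sym C2 -> nnd_sym (C1 + C2).
Proof.
move=> [s1 p1] [s2 p2]; split; first by rewrite linearD /= s1 s2.
by move=> x; rewrite mulmxDr mulmxDl mxE addr_ge0.
Qed.

Definition simul_perm s C : 'M[R]_t := \matrix_(i, j) C (s i) (s j).

Lemma nnd_simul_perm s C : nnd_sym C -> nnd_sym (simul_perm s C).
Proof.
move=> [Cs Cp]; split.
  by apply/matrixP => i j; rewrite !mxE -[in LHS]Cs mxE.
(* The quadratic form of the permuted matrix at x is that of C at x with its coordinates permuted by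
   the inverse of s. *)
move=> x; have := Cp (\col_i x (s^-1%g i) ord0); congr (0 <= _).
rewrite !mxE (reindex_inj (@perm_inj _ s)) /=; apply: eq_bigr => j _.
rewrite !mxE permK; congr (_ * _).
rewrite (reindex_inj (@perm_inj _ s)) /=; apply: eq_bigr => i _.
by rewrite !mxE permK.
Qed.

Definition centering : 'M[R]_t := 1%:M - t%:R^-1 *: const_mx 1.

(** The common diagonal entry is tr C / t, and a zero row sum forces every off-diagonal entry to be
    -1/(t-1) times it. *)
Lemma completely_symmetricE C : (1 < t)%N ->
    (forall i j, C i i = C j j) ->
    (forall i j l, j != i -> l != i -> C i j = C i l) ->
    (forall i, \sum_j C i j = 0) ->
  C = (\tr C / (t.-1)%:R) *: centering.
Proof.
move=> t1 Cd Co Cr.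
have t0 : (t%:R : R) != 0 by rewrite pnatr_eq0; lia.
have t10 : ((t.-1)%:R : R) != 0 by rewrite pnatr_eq0; lia.
have tE : (t%:R : R) = (t.-1)%:R + 1 by rewrite natr1 prednK //; lia.
have trE i : \tr C = t%:R * C i i.
  rewrite /mxtrace (eq_bigr (fun=> C i i)) => [|j _]; last exact: Cd.
  by rewrite sumr_const card_ord mulr_natl.
apply/matrixP => i j; rewrite !mxE (trE i).
have [<-|ij] := eqVneq i j; first by rewrite /= tE; field; rewrite -tE t0 t10.
have := Cr i; rewrite (bigD1 i) //= (eq_bigr (fun=> C i j)) => [|l li]; last first.
  by apply: Co => //; rewrite eq_sym.
rewrite sumr_const cardC1 card_ord -mulr_natl => /eqP; rewrite addr_eq0 => /eqP ->.
by rewrite /= sub0r mulr1; field; rewrite t0 t10.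
Qed.

Lemma nnd_centering : (0 < t)%N -> nnd_sym centering.
Proof.
move=> t0; have t0' : (t%:R : R) != 0 by rewrite pnatr_eq0; lia.
have cs : centering^T = centering.
  by rewrite linearB linearZ /= trmx1 trmx_const.
have -> : centering = centering^T *m centering; last exact: nnd_gram.
rewrite cs {2}/centering mulmxBr mulmx1 -scalemxAr.
suff -> : centering *m const_mx 1 = 0 :> 'M_t by rewrite scaler0 subr0.
rewrite mulmxBl mul1mx -scalemxAl; apply/matrixP => i j; rewrite !mxE.
rewrite (eq_bigr (fun=> 1)) => [|l _]; last by rewrite !mxE mulr1.
by rewrite sumr_const card_ord mulVf ?subrr.
Qed.

Section Criterion.
Local Open Scope ereal_scope.
Variable Phi : 'M[R]_t -> \bar R.
Hypothesis PhiP : Kiefer_criterion Phi.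

(** Convexity is recast through sublevel sets so that averaging needs no arithmetic with infinite
    values: the bound +oo is trivial, and -oo is excluded because Phi never takes it. *)
Lemma criterion_sublevel_convex C1 C2 (a : R) v :
    nnd_sym C1 -> nnd_sym C2 -> (0 < a < 1)%R -> Phi C1 <= v -> Phi C2 <= v ->
  Phi (a *: C1 + (1 - a) *: C2)%R <= v.
Proof.
move=> n1 n2 a01 l1 l2; have [Pn Pc _ _] := PhiP.
apply: (le_trans (Pc _ _ _ n1 n2 a01)); have := Pn _ n1; have := Pn _ n2.
move: l1 l2; case: v => [v||]; last 2 first.
- by move=> *; rewrite leey.
- by rewrite leeNy_eq => /eqP ->.
case: (Phi C1) => [x||] //; case: (Phi C2) => [y||] // l1 l2 _ _.
rewrite -!EFinM -EFinD lee_fin; move: l1 l2; rewrite !lee_fin => l1 l2.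
by move: a01 => /andP[a0 a1]; nra.
Qed.

Lemma criterion_mean (I : Type) (r : seq I) (F : I -> 'M[R]_t) v :
    (0 < size r)%N -> (forall i, nnd_sym (F i)) -> (forall i, Phi (F i) <= v) ->
  Phi ((size r)%:R^-1 *: \sum_(i <- r) F i)%R <= v.
Proof.
move=> + Fn Fv.
elim: r => [//|x [|y r] IH] _; first by rewrite big_seq1 invr1 scale1r.
have : (0 < size (y :: r))%N by [].
move: (y :: r) IH => s IH sP; have s0 : ((size s)%:R : R) != 0%R by rewrite pnatr_eq0 -lt0n.
have s1 : ((size s)%:R + 1 : R)%R != 0%R by rewrite natr1 pnatr_eq0.
(* The mean of n+1 matrices is the convex combination of the head, with weight 1/(n+1), and the mean
   of the other n. *)
pose a : R := ((size s)%:R + 1)^-1%R.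
have -> : ((size (x :: s))%:R^-1 *: (\sum_(i <- x :: s) F i) =
   a *: F x + (1 - a) *: ((size s)%:R^-1 *: \sum_(i <- s) F i))%R.
  rewrite big_cons scalerDr scalerA /= -natr1; congr (_ + _ *: _)%R.
  by rewrite /a; field; rewrite s0 s1.
apply: criterion_sublevel_convex => //; last exact: IH.
  apply: nnd_scale; first by rewrite invr_ge0 ler0n.
  elim: (s) => [|z q IHq]; last by rewrite big_cons; apply: nnd_add.
  rewrite big_nil; split; first by rewrite trmx0.
  by move=> z; rewrite mulmx0 mul0mx mxE.
by rewrite /a natr1 invr_gt0 ltr0n /= invf_lt1 ?ltr0n // ltr1n.
Qed.

(* Averaging over the symmetric group keeps the trace and, by convexity, does not increase Phi. *)
Lemma criterion_centering_le C : (1 < t)%N -> nnd_sym C ->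
    (forall i, \sum_j C i j = 0)%R ->
  Phi ((\tr C / (t.-1)%:R) *: centering)%R <= Phi C.
Proof.
move=> t1 nC Cr; have [_ _ _ Ps] := PhiP.
pose r := index_enum {perm 'I_t}.
have r0 : (0 < size r)%N.
  by have := mem_index_enum (1%g : 'S_t); rewrite -/r; case: (r).
have rn : ((size r)%:R : R) != 0%R by rewrite pnatr_eq0 -lt0n.
pose D := ((size r)%:R^-1 *: \sum_(s : 'S_t) simul_perm s C)%R.
have De i j : D i j = ((size r)%:R^-1 * \sum_(s : 'S_t) C (s i) (s j))%R.
  by rewrite mxE summxE; congr (_ * _)%R; apply: eq_bigr => s _; rewrite mxE.
(* Left translation by [u^-1] only permutes the summands. Transpositions will then identify the
   diagonal entries with each other, and the off-diagonal entries within each row. *)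
have Dinv (u : 'S_t) i j : D (u i) (u j) = D i j.
  rewrite !De; congr (_ * _)%R; rewrite (reindex_inj (mulgI u^-1%g)) /=.
  by apply: eq_bigr => s _; rewrite !permM !permK.
have Dtr : \tr D = \tr C.
  rewrite linearZ /= raddf_sum /= (eq_bigr (fun=> \tr C)) => [|s _]; last first.
    rewrite [RHS](reindex_inj (@perm_inj _ s)) /=.
    by apply: eq_bigr => i _; rewrite mxE.
  by rewrite big_const_seq count_predT iter_addr_0 -[RHS](mulKf rn) mulr_natl.
rewrite -Dtr -completely_symmetricE //.
- apply: (@criterion_mean _ r (fun s => simul_perm s C)) => // s.
    exact: nnd_simul_perm.
  by rewrite Ps.
- by move=> i j; rewrite -(Dinv (tperm i j) i i) tpermL.
- move=> i j l ji li.
  by rewrite -(Dinv (tperm j l) i j) tpermL tpermD.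
- move=> i; under eq_bigr do rewrite De.
  rewrite -mulr_sumr exchange_big /= big1 ?mulr0 // => s _.
  by rewrite -[RHS](Cr (s i)) [RHS](reindex_inj (@perm_inj _ s)).
Qed.

End Criterion.
End Kiefer.

(** * The information matrix for total effects and its trace bound *)

Section InformationMatrix.
Variables (R : realType) (t b k : nat).
Implicit Type d : design t b k.

Lemma sum_plots (V : nmodType) (F : 'I_b -> 'I_k -> V) :
  \sum_(r : 'I_(b * k)) F (blk r) (plt r) = \sum_i \sum_j F i j.
Proof.
(* The decoding is injective by Euclidean division, hence bijective because both sides have bk
   elements. *)
pose f (r : 'I_(b * k)) : 'I_b * 'I_k := (blk r, plt r).
have f_inj : injective f.
  move=> r r' [] e1 e2; apply: val_inj => /=.
  by rewrite (divn_eq r k) (divn_eq r' k) e1 e2.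
have f_bij : bijective f.
  by apply: inj_card_bij => //; rewrite card_prod !card_ord.
rewrite pair_big /= [RHS](reindex f) //.
exact: onW_bij.
Qed.

Lemma sum_rnb (V : nmodType) (F : 'I_k -> V) : \sum_j F (rnb j) = \sum_j F j.
Proof. by rewrite [RHS](reindex_inj (@ordS_inj k)). Qed.

Lemma sum_lnb (V : nmodType) (F : 'I_k -> V) : \sum_j F (lnb j) = \sum_j F j.
Proof. by rewrite [RHS](reindex_inj (@ord_pred_inj k)). Qed.

(** The orthogonal projector onto the complement of the block space, explicit because B'B = kI. *)
Definition block_centering : 'M[R]_(b * k) :=
  1%:M - k%:R^-1 *: (Bmx R b k *m (Bmx R b k)^T).

Lemma block_gram : (Bmx R b k)^T *m Bmx R b k = k%:R%:M.
Proof.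
apply/matrixP => i i'; rewrite !mxE.
transitivity (\sum_(u < b) \sum_(j < k) ((u == i)%:R * (u == i')%:R : R)).
  by rewrite -sum_plots; apply: eq_bigr => r _; rewrite !mxE.
under eq_bigr do rewrite sumr_const card_ord.
rewrite (bigD1 i) //= eqxx mul1r big1 => [|u /negPf ->]; last by rewrite mul0r mul0rn.
by rewrite addr0; case: (i == i'); rewrite ?mul0rn.
Qed.

Lemma tr_block_centering : block_centering^T = block_centering.
Proof. by rewrite linearB linearZ /= trmx1 trmx_mul trmxK. Qed.

Hypothesis k_gt0 : (0 < k)%N.

Let kR_neq0 : (k%:R : R) != 0.
Proof. by rewrite pnatr_eq0 -lt0n. Qed.

Lemma block_centering_mul0 : block_centering *m Bmx R b k = 0.
Proof.
rewrite mulmxBl mul1mx -scalemxAl -mulmxA block_gram mul_mx_scalar scalerA.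
by rewrite mulVf // scale1r subrr.
Qed.

Lemma mul_block_centering0 : (Bmx R b k)^T *m block_centering = 0.
Proof.
by apply: trmx_inj; rewrite trmx_mul trmxK tr_block_centering block_centering_mul0 trmx0.
Qed.

Lemma block_centering_idem : block_centering *m block_centering = block_centering.
Proof.
rewrite {2}/block_centering mulmxBr mulmx1 -scalemxAr mulmxA.
by rewrite block_centering_mul0 mul0mx scaler0 subr0.
Qed.

(* [mean_effects] and [nuisance] are the X_1 and X_2 of the paper once (K'K)^+ is computed to be I/3. *)
Definition mean_effects d : 'M[R]_(b * k, t) :=
  3%:R^-1 *: (Tmx R d + Lmx R d + Rmx R d).

Definition nuisance d : 'M[R]_(b * k, t + t + t + b) :=
  row_mx (Amx R d *m (1%:M - 3%:R^-1 *: (Kmx R t *m (Kmx R t)^T))) (Bmx R b k).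

Let three_neq0 : (3%:R : R) != 0. Proof. by rewrite pnatr_eq0. Qed.

Lemma Kmx_gram : (Kmx R t)^T *m Kmx R t = 3%:R%:M.
Proof.
rewrite /Kmx !tr_col_mx !mul_row_col !trmx1 !mul1mx.
by apply/matrixP => i j; rewrite !mxE; case: (i == j); rewrite ?mulr1n ?mulr0n; ring.
Qed.

Lemma info_psiE d :
  info_psi R d = (mean_effects d)^T *m prperp (nuisance d) *m mean_effects d.
Proof.
rewrite /info_psi Kmx_gram MPinv_scalar // /nuisance !mul_mx_scalar -scalemxAl.
have -> // : 3%:R^-1 *: (Amx R d *m Kmx R t) = mean_effects d.
by rewrite /Amx /Kmx !mul_row_col !mulmx1.
Qed.

Lemma nuisance_block d : prperp (nuisance d) *m Bmx R b k = 0.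
Proof.
have := prperp_mul0 (nuisance d); rewrite {2}/nuisance mul_mx_row.
by rewrite -[X in _ = X]row_mx0 => /eq_row_mx[].
Qed.

Lemma prperp_nuisance_centering d :
  prperp (nuisance d) *m block_centering = prperp (nuisance d).
Proof.
by rewrite mulmxBr mulmx1 -scalemxAr mulmxA nuisance_block mul0mx scaler0 subr0.
Qed.

(** The nuisance matrix contains the block columns, so its complementary projector absorbs
    [block_centering] on either side. Centering before that projector is dropped is what makes the
    trace bound attainable. *)
Lemma info_psi_centered d :
  info_psi R d = (block_centering *m mean_effects d)^T *m prperp (nuisance d)
                   *m (block_centering *m mean_effects d).
Proof.
have := prperp_nuisance_centering d; have := tr_prperp (nuisance d).
have := tr_block_centering; rewrite info_psiE.
move: (prperp _) block_centering (mean_effects d) => P Q X Qs Ps PQ.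
have QP : Q *m P = P by have := congr1 trmx PQ; rewrite trmx_mul Qs Ps.
by rewrite trmx_mul Qs !mulmxA -(mulmxA _ Q P) QP -(mulmxA _ P Q) PQ.
Qed.

Lemma info_psi_gram d :
  info_psi R d = (prperp (nuisance d) *m mean_effects d)^T
                   *m (prperp (nuisance d) *m mean_effects d).
Proof.
have := prperp_idem (nuisance d); have := tr_prperp (nuisance d); rewrite info_psiE.
move: (prperp _) (mean_effects d) => P X Ps PP.
by rewrite trmx_mul Ps !mulmxA -(mulmxA _ P P) PP.
Qed.

(** Each row of either matrix sums to one: raising all total effects equally cannot be told apart
    from raising all block effects. Zero row sums of the information matrix follow. *)
Lemma mean_effects_const d :
  mean_effects d *m const_mx 1 = Bmx R b k *m const_mx 1 :> 'cV_(b * k).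
Proof.
have sum1 n (x : 'I_n) : \sum_(c < n) ((x == c)%:R : R) = 1.
  by rewrite (bigD1 x) //= eqxx big1 ?addr0 // => c /negPf; rewrite eq_sym => ->.
apply/matrixP => r z; rewrite !mxE.
under eq_bigr do rewrite !mxE mulr1 !mulrDr.
under [RHS]eq_bigr do rewrite !mxE mulr1.
rewrite !big_split /= -!mulr_sumr !sum1.
by field.
Qed.

Lemma info_psi_row_sum d i : \sum_j info_psi R d i j = 0.
Proof.
have : info_psi R d *m const_mx 1 = 0 :> 'cV_t.
  by rewrite info_psiE -!mulmxA mean_effects_const (mulmxA (prperp _))
       nuisance_block mul0mx mulmx0.
move/matrixP => /(_ i ord0); rewrite [LHS]mxE [RHS]mxE => C0.
by rewrite -[RHS]C0; apply: eq_bigr => j _; rewrite [const_mx _ _ _]mxE mulr1.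
Qed.

Definition centered_gram d : 'M[R]_t :=
  (mean_effects d)^T *m block_centering *m mean_effects d.

Lemma centered_gramE d :
  (block_centering *m mean_effects d)^T *m (block_centering *m mean_effects d)
    = centered_gram d.
Proof.
have := block_centering_idem; have := tr_block_centering; rewrite /centered_gram.
move: block_centering (mean_effects d) => Q X Qs QQ.
by rewrite trmx_mul Qs !mulmxA -(mulmxA _ Q Q) QQ.
Qed.

Lemma tr_info_psi_le d : \tr (info_psi R d) <= \tr (centered_gram d).
Proof. by rewrite info_psi_centered -centered_gramE tr_prperp_le. Qed.

Definition block_count d (i : 'I_b) (c : 'I_t) : nat := \sum_(j < k) (d i j == c).

(** On a circular block both neighbor shifts permute the plots, so T, L and R have the same block
    counts and the factor 1/3 cancels. *)
Lemma block_mean_effects d i c :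
  ((Bmx R b k)^T *m mean_effects d) i c = (block_count d i c)%:R.
Proof.
rewrite !mxE.
transitivity (\sum_(u < b) (u == i)%:R * (3%:R^-1 * \sum_(j < k) (((d u j == c)%:R : R)
     + (d u (lnb j) == c)%:R + (d u (rnb j) == c)%:R))).
  under [RHS]eq_bigr do rewrite !mulr_sumr.
  by rewrite -sum_plots; apply: eq_bigr => r _; rewrite !mxE.
rewrite (bigD1 i) //= eqxx mul1r [X in _ + X]big1 => [|u /negPf ->]; last by rewrite mul0r.
rewrite addr0 !big_split /=.
rewrite (sum_lnb (fun j => (d i j == c)%:R)) (sum_rnb (fun j => (d i j == c)%:R)).
by rewrite /block_count natr_sum; field.
Qed.

Lemma centered_gram_entry d a c :
  centered_gram d a c =
    ((mean_effects d)^T *m mean_effects d) a c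
    - k%:R^-1 * \sum_i (block_count d i a)%:R * (block_count d i c)%:R.
Proof.
have := block_mean_effects d; rewrite /centered_gram.
move: (mean_effects d) => X XE.
rewrite mulmxBr mulmx1 mulmxBl -scalemxAr -scalemxAl.
have -> : X^T *m (Bmx R b k *m (Bmx R b k)^T) *m X =
  ((Bmx R b k)^T *m X)^T *m ((Bmx R b k)^T *m X) by rewrite trmx_mul trmxK !mulmxA.
rewrite mxE; congr (_ + _); rewrite mxE; congr (- _); rewrite mxE; congr (_ * _).
by rewrite mxE; apply: eq_bigr => i _; rewrite mxE !XE.
Qed.

Lemma sum_block_count d i : (\sum_c block_count d i c = k)%N.
Proof.
rewrite exchange_big /= (eq_bigr (fun=> 1%N)) => [|j _].
  by rewrite sum_nat_const card_ord muln1.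
by rewrite (bigD1 (d i j)) //= eqxx big1 // => c /negPf; rewrite eq_sym => ->.
Qed.

Lemma tr_mean_gram d : no_self_nb d ->
  \tr ((mean_effects d)^T *m mean_effects d) = b%:R * k%:R / 3%:R.
Proof.
move=> nd; rewrite tr_gram exchange_big /=.
pose G (i : 'I_b) (j : 'I_k) : R := \sum_c (3%:R^-1 *
  ((d i j == c)%:R + (d i (lnb j) == c)%:R + (d i (rnb j) == c)%:R)) ^+ 2.
transitivity (\sum_r G (blk r) (plt r)).
  by apply: eq_bigr => r _; apply: eq_bigr => c _; rewrite !mxE.
rewrite sum_plots.
suff GE i j : G i j = 3%:R^-1.
  under eq_bigr do under eq_bigr do rewrite GE.
  by rewrite !sumr_const !card_ord -[LHS]mulr_natl -[X in _ * X = _]mulr_natl mulrA.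
(* The hypothesis at plot j separates its treatment from the left neighbor and the two neighbors
   from each other; the remaining pair is the distance-1 condition at plot j+1. *)
have [lt rl] := nd i j; have [rt _] := nd i (rnb j).
have rK : lnb (rnb j) = j by exact: ordSK.
rewrite rK in rt.
rewrite /G (bigD1 (d i j)) //= (bigD1 (d i (lnb j))) /=; last by rewrite eq_sym.
rewrite (bigD1 (d i (rnb j))) /=; last by rewrite rt eq_sym.
rewrite big1 => [|c /andP[/andP[c1 c2] c3]].
  rewrite !eqxx (negPf lt) (negPf rt) (negPf rl).
  rewrite -(eq_sym (d i j)) (negPf lt) -(eq_sym (d i (rnb j))) (negPf rt).
  rewrite -(eq_sym (d i (lnb j))) (negPf rl) /=.
  by field.
by rewrite ![_ == c]eq_sym (negPf c1) (negPf c2) (negPf c3) !addr0 mulr0 expr0n.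
Qed.

Lemma tr_centered_gram d : no_self_nb d ->
  \tr (centered_gram d) =
    b%:R * k%:R / 3%:R - k%:R^-1 * (\sum_i \sum_c block_count d i c ^ 2)%:R.
Proof.
move=> nd; rewrite -(tr_mean_gram nd) /mxtrace.
under [LHS]eq_bigr do rewrite centered_gram_entry.
rewrite sumrB -mulr_sumr exchange_big /= natr_sum; congr (_ - _ * _).
by apply: eq_bigr => i _; rewrite natr_sum; apply: eq_bigr => c _; rewrite natrM.
Qed.

(** The counts in a block are natural numbers with sum k, and n <= n^2, so their squares sum to at
    least k. Equality means counts 0 and 1, that is, a binary block. *)
Lemma tr_info_psi_ub d : no_self_nb d ->
  \tr (info_psi R d) <= b%:R * k%:R / 3%:R - b%:R.
Proof.
move=> nd; apply: le_trans (tr_info_psi_le d) _.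
rewrite tr_centered_gram // lerD2l lerN2 ler_pdivlMl ?ltr0n // -natrM ler_nat.
rewrite mulnC -{1}(card_ord b) -sum_nat_const; apply: leq_sum => i _.
rewrite -(sum_block_count d i); apply: leq_sum => c _.
by case: block_count => // n; rewrite expnS leq_pmulr.
Qed.

(** A common form of [Tmx], [Lmx] and [Rmx], which are convertible to it with the plot index shifted
    by the identity, [lnb] and [rnb]. *)
Definition incidence (e : 'I_b -> 'I_k -> 'I_t) : 'M[R]_(b * k, t) :=
  \matrix_(r, c) (e (blk r) (plt r) == c)%:R.

Lemma incidence_gram (e f : 'I_b -> 'I_k -> 'I_t) a c :
  ((incidence e)^T *m incidence f) a c =
    (\sum_i \sum_j ((e i j == a) && (f i j == c)))%:R.
Proof.
rewrite -sum_plots natr_sum mxE; apply: eq_bigr => r _.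
by rewrite !mxE -natrM mulnb.
Qed.

Lemma sum_plots_card (P : 'I_b -> 'I_k -> bool) :
  (\sum_i \sum_j P i j)%N = #|[set p : 'I_b * 'I_k | P p.1 p.2]|.
Proof.
rewrite pair_big /= -sum1_card [RHS]big_mkcond /=; apply: eq_bigr => p _.
by rewrite inE; case: (P _ _).
Qed.

Lemma replicationE d a : replication d a = (\sum_i block_count d i a)%N.
Proof. by rewrite /replication -(sum_plots_card (fun i j => d i j == a)). Qed.

Lemma block_incidence d (s : 'I_k -> 'I_k) : injective s ->
  (Bmx R b k)^T *m incidence (fun i j => d i (s j)) =
    \matrix_(i, c) (block_count d i c)%:R.
Proof.
move=> s_inj; apply/matrixP => i c; rewrite !mxE.
transitivity (\sum_(u < b) \sum_(j < k) ((u == i)%:R * (d u (s j) == c)%:R : R)).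
  by rewrite -sum_plots; apply: eq_bigr => r _; rewrite !mxE.
rewrite (bigD1 i) //= eqxx [X in _ + X]big1 ?addr0 => [|u /negPf ->]; last first.
  by rewrite big1 // => j _; rewrite mul0r.
rewrite /block_count natr_sum [RHS](reindex_inj s_inj) /=.
by apply: eq_bigr => j _; rewrite mul1r.
Qed.

(** With at least three plots on the circle, j-1 differs from both j and j+1 modulo k. *)
Lemma binary_no_self_nb d : (2 < k)%N -> binary d -> no_self_nb d.
Proof.
move=> k3 bd i j; rewrite !(inj_eq (bd i)); split.
  rewrite -val_eqE /=; have := ltn_ord j; move: (nat_of_ord j) => m mk.
  have [->|m0] := posnP m; first by rewrite add0n modn_small; lia.
  have -> : ((m + k).-1 = m.-1 + k)%N by lia.
  by rewrite modnDr modn_small; lia.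
(* Taking the left neighbor as the new variable m turns the claim into m differing from m+2 modulo
   k. *)
rewrite -{2}[j]ord_predK -[ord_pred j]/(lnb j); move: (lnb j) => {}j.
rewrite -val_eqE /=; have := ltn_ord j; move: (nat_of_ord j) => m mk.
have [m1|m1] := ltnP m.+1 k.
  rewrite (modn_small m1); have [m2|m2] := ltnP m.+2 k.
    by rewrite modn_small //; lia.
  have -> : m.+2 = k by lia.
  by rewrite modnn; lia.
have -> : m.+1 = k by lia.
by rewrite modnn modn_small; lia.
Qed.

Lemma block_count_binary d i c : binary d -> block_count d i c = [exists j, d i j == c].
Proof.
move=> bd; rewrite /block_count; case: existsP => [[j /eqP <-]|nj].
  rewrite (bigD1 j) //= eqxx big1 // => j' jj'.
  by rewrite (inj_eq (bd i)) (negPf jj').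
by rewrite big1 // => j _; case: eqP => // e; case: nj; exists j; apply/eqP.
Qed.

(** Counts of a binary design are indicators, so their products flag the blocks containing both
    treatments. The block term thus becomes the constants supplied by [BBD]. *)
Lemma sum_block_count_binary d a c : binary d ->
  (\sum_i block_count d i a * block_count d i c =
    if a == c then replication d a else concurrence d a c)%N.
Proof.
move=> bd; have [<-|ac] := eqVneq a c.
  rewrite replicationE; apply: eq_bigr => i _.
  by rewrite block_count_binary //; case: [exists _, _].
rewrite /concurrence -sum1_card [RHS]big_mkcond /=; apply: eq_bigr => i _.
by rewrite !block_count_binary // inE mulnb; case: (_ && _).
Qed.

(** * Attainment of the trace bound by neighbor-balanced designs *)

Section NeighborBalanced.
Variables (l : nat) (d : design t b k).
Hypotheses (k_gt2 : (2 < k)%N) (dP : CNBD2 l d).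

Let d_binary : binary d. Proof. by case: dP => [[]]. Qed.

Let d_no_self : no_self_nb d.
Proof. exact: binary_no_self_nb. Qed.

Let Tm := Tmx R d.
Let Lm := Lmx R d.
Let Rm := Rmx R d.
(** The Gram matrix of (T|L|R) will have 3 by 3 blocks, [D] on the diagonal and [E] off it; [S] is a
    third of any block row sum. *)
Let E : 'M[R]_t := l%:R *: (const_mx 1 - 1%:M).
Let D : 'M[R]_t := diag_mx (\row_a (replication d a)%:R).
Let S : 'M[R]_t := 3%:R^-1 *: (D + E + E).

Let trE : E^T = E.
Proof. by rewrite linearZ linearB /= trmx_const trmx1. Qed.

Let gram_shift (s : 'I_k -> 'I_k) : injective s ->
  (incidence (fun i j => d i (s j)))^T *m incidence (fun i j => d i (s j)) = D.
Proof.
move=> s_inj; apply/matrixP => a c; rewrite incidence_gram !mxE.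
have [<-|ac] := eqVneq a c.
  rewrite replicationE mulr1n; congr _%:R; apply: eq_bigr => i _.
  rewrite /block_count [RHS](reindex_inj s_inj) /=.
  by apply: eq_bigr => j _; rewrite andbb.
rewrite mulr0n big1 // => i _; rewrite big1 // => j _.
by case: eqP => // ->; rewrite (negPf ac).
Qed.

Let gram_neighbors (e f : 'I_b -> 'I_k -> 'I_t) :
    (forall i j, e i j != f i j) ->
    (forall a c, a != c ->
       #|[set p : 'I_b * 'I_k | (e p.1 p.2 == a) && (f p.1 p.2 == c)]| = l) ->
  (incidence e)^T *m incidence f = E.
Proof.
move=> ef cnt; apply/matrixP => a c; rewrite incidence_gram !mxE.
have [<-|ac] := eqVneq a c.
  rewrite mulr1n subrr mulr0 big1 // => i _; rewrite big1 // => j _.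
  by case: eqP => // <-; rewrite eq_sym (negPf (ef i j)).
rewrite (sum_plots_card (fun i j => (e i j == a) && (f i j == c))) cnt //.
by rewrite mulr0n subr0 mulr1.
Qed.

Let TT : Tm^T *m Tm = D. Proof. exact: (@gram_shift id). Qed.
Let LL : Lm^T *m Lm = D. Proof. exact/gram_shift/ord_pred_inj. Qed.
Let RR : Rm^T *m Rm = D. Proof. exact/gram_shift/ordS_inj. Qed.

Let TR : Tm^T *m Rm = E.
Proof.
apply: (@gram_neighbors d (fun i j => d i (rnb j))) => [i j|].
  by have [+ _] := d_no_self i (rnb j); rewrite /lnb ordSK eq_sym.
by case: dP => [[_ []]].
Qed.

Let LR : Lm^T *m Rm = E.
Proof.
apply: (@gram_neighbors (fun i j => d i (lnb j)) (fun i j => d i (rnb j))) => [i j|].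
  by have [] := d_no_self i j.
by case: dP.
Qed.

Let RT : Rm^T *m Tm = E.
Proof. by apply: trmx_inj; rewrite trE trmx_mul trmxK TR. Qed.

Let RL : Rm^T *m Lm = E.
Proof. by apply: trmx_inj; rewrite trE trmx_mul trmxK LR. Qed.

Let TL : Tm^T *m Lm = E.
Proof.
rewrite -RT; apply/matrixP => a c.
rewrite (incidence_gram d (fun i j => d i (lnb j))) (incidence_gram (fun i j => d i (rnb j)) d).
(* Shifting the plot index by one turns pairs (plot, left neighbor) into pairs (right neighbor,
   plot). *)
congr _%:R; apply: eq_bigr => i _; rewrite -sum_rnb; apply: eq_bigr => j _.
by rewrite /lnb ordSK.
Qed.

Let LT : Lm^T *m Tm = E.
Proof. by apply: trmx_inj; rewrite trE trmx_mul trmxK TL. Qed.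

Let effects_mean_gram : [/\ Tm^T *m mean_effects d = S,
  Lm^T *m mean_effects d = S & Rm^T *m mean_effects d = S].
Proof.
rewrite /mean_effects -/Tm -/Lm -/Rm.
split; rewrite -scalemxAr !mulmxDr ?(TT, TL, TR, LT, LL, LR, RT, RL, RR) //.
- by rewrite [E + D]addrC.
- by rewrite [E + E + D]addrC addrA.
Qed.

Let mean_gram : (mean_effects d)^T *m mean_effects d = S.
Proof.
have [TX LX RX] := effects_mean_gram.
have XT : (mean_effects d)^T = 3%:R^-1 *: (Tm^T + Lm^T + Rm^T).
  by rewrite linearZ /= !linearD.
move: (mean_effects d) TX LX RX XT => X TX LX RX ->.
rewrite -scalemxAl !mulmxDl TX LX RX; apply/matrixP => a c; rewrite mxE 2!mxE.
by field.
Qed.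

(** T, L and R have equal products with the mean effects and with B, so their products with the
    centered mean effects coincide in one matrix G. Stacking gives KG, which the factor M of the
    nuisance matrix annihilates; centering takes care of the block columns. *)
Lemma nuisance_centered_mean_effects :
  (nuisance d)^T *m (block_centering *m mean_effects d) = 0.
Proof.
have [TX LX RX] := effects_mean_gram.
have BT : (Bmx R b k)^T *m Tm = \matrix_(i, c) (block_count d i c)%:R.
  exact: (@block_incidence d id).
have BL : (Bmx R b k)^T *m Lm = (Bmx R b k)^T *m Tm.
  by rewrite BT; apply/block_incidence/ord_pred_inj.
have BR : (Bmx R b k)^T *m Rm = (Bmx R b k)^T *m Tm.
  by rewrite BT; apply/block_incidence/ordS_inj.
pose G := Tm^T *m (block_centering *m mean_effects d).
have GE (W : 'M[R]_(b * k, t)) : W^T *m mean_effects d = S ->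
    (Bmx R b k)^T *m W = (Bmx R b k)^T *m Tm ->
    W^T *m (block_centering *m mean_effects d) = G.
  rewrite /G; move: TX; move: (mean_effects d) Tm => X T TX WX BW.
  have WB : W^T *m Bmx R b k = T^T *m Bmx R b k.
    by apply: trmx_inj; rewrite !trmx_mul !trmxK.
  rewrite !mulmxA !mulmxBr !mulmx1 !mulmxBl WX TX; congr (_ - _).
  by rewrite -!scalemxAr !mulmxA WB.
have AG : (Amx R d)^T *m (block_centering *m mean_effects d) = Kmx R t *m G.
  rewrite /Amx /Kmx !tr_row_mx !mul_col_mx !mul1mx -/Tm -/Lm -/Rm.
  by rewrite !GE.
rewrite /nuisance tr_row_mx mul_col_mx (mulmxA (Bmx R b k)^T).
rewrite mul_block_centering0 mul0mx trmx_mul -mulmxA AG.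
(* Since K'K = 3I, the matrix I - KK'/3 sends K to zero. *)
rewrite mulmxA linearB linearZ /= trmx1 trmx_mul trmxK mulmxBl mul1mx -scalemxAl.
rewrite -(mulmxA (Kmx R t)) Kmx_gram mul_mx_scalar scalerA mulVf // scale1r.
by rewrite subrr mul0mx col_mx0.
Qed.

Lemma info_psi_neighbor_balanced : info_psi R d = centered_gram d.
Proof.
rewrite info_psi_centered -centered_gramE -mulmxA prperp_orth //.
exact: nuisance_centered_mean_effects.
Qed.

Lemma tr_info_psi_neighbor_balanced :
  \tr (info_psi R d) = b%:R * k%:R / 3%:R - b%:R.
Proof.
rewrite info_psi_neighbor_balanced tr_centered_gram //; congr (_ - _).
suff -> : (\sum_i \sum_c block_count d i c ^ 2 = b * k)%N by rewrite natrM; field.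
transitivity (\sum_(i < b) k)%N; last by rewrite sum_nat_const card_ord.
(* Counts of a binary design are 0 or 1, hence equal to their squares. *)
apply: eq_bigr => i _; rewrite -[RHS](sum_block_count d i); apply: eq_bigr => c _.
by rewrite block_count_binary //; case: [exists _, _].
Qed.

(** The matrix is S - N'N/k with N the block-treatment counts. Equal replication and constant
    concurrence make both terms completely symmetric, and the trace fixes the multiple. *)
Lemma info_psi_neighbor_balancedE : (1 < t)%N ->
  info_psi R d = ((b%:R * k%:R / 3%:R - b%:R) / (t.-1)%:R) *: centering R t.
Proof.
move=> t1; rewrite -tr_info_psi_neighbor_balanced.
have [[_ [[rep [lam conc]] _]] _] := dP.
apply: completely_symmetricE => //; last exact: info_psi_row_sum.
  move=> a c; rewrite info_psi_neighbor_balanced !centered_gram_entry mean_gram.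
  under eq_bigr do rewrite -natrM.
  under [X in _ = _ - _ * X]eq_bigr do rewrite -natrM.
  by rewrite -!natr_sum !sum_block_count_binary // !eqxx !mxE !eqxx (rep a c).
move=> a c e ca ea; rewrite info_psi_neighbor_balanced !centered_gram_entry mean_gram.
under eq_bigr do rewrite -natrM.
under [X in _ = _ - _ * X]eq_bigr do rewrite -natrM.
rewrite -!natr_sum !sum_block_count_binary // ![a == _]eq_sym (negPf ca) (negPf ea).
by rewrite !mxE ![a == _]eq_sym (negPf ca) (negPf ea) !conc // eq_sym.
Qed.

End NeighborBalanced.
End InformationMatrix.

Theorem theorem7 (R : realType) (t b k : nat) (dstar : design t b k) :
  (0 < b)%N -> (4 <= k)%N -> (k <= t)%N ->
  (t * (t - 1) %| b * k)%N ->
  CNBD2 ((b * k) %/ (t * (t - 1))) dstar ->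
  universally_optimal (@info_psi R t b k) (@no_self_nb t b k) dstar.
Proof.
move=> b_gt0 k_ge4 k_le_t _ dstarP Phi PhiP d d_no_self.
have k_gt0 : (0 < k)%N by lia.
have k_gt2 : (2 < k)%N by lia.
have t_gt1 : (1 < t)%N by lia.
rewrite (info_psi_neighbor_balancedE R k_gt0 k_gt2 dstarP t_gt1).
have nd : nnd_sym (info_psi R d) by rewrite info_psi_gram; apply: nnd_gram.
(* Averaging replaces the competitor by a multiple of the centering matrix. Two multiples remain,
   compared by monotonicity of Phi in the scalar, which requires the smaller one to be
   nonnegative. *)
apply: (le_trans _ (criterion_centering_le PhiP t_gt1 nd (info_psi_row_sum R d))).
have [_ _ Pm _] := PhiP; apply: Pm; first by apply: nnd_centering; lia.
have tr_ge0 : 0 <= \tr (info_psi R d) by rewrite info_psi_gram; apply: tr_gram_ge0.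
by rewrite divr_ge0 //= ler_pM2r ?tr_info_psi_ub // invr_gt0 ltr0n; lia.
Qed.
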